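(* Let $\mathbf s$ be a perm-complete finite sequence in $\mathrm{Sym}(n)$. Then every finite sequence in $\mathrm{Sym}(n)$ obtained from $\mathbf s$ by inserting additional terms (arbitrary elements of $\mathrm{Sym}(n)$) is perm-complete.
   Context: $n=\{0,1,\ldots,n-1\}$; $\mathrm{Sym}(n)$, $\mathrm{Alt}(n)$ are the symmetric and alternating groups; permutations compose left to right. For $\mathbf s=\langle s_0,\ldots,s_{k-1}\rangle$ in $\mathrm{Sym}(n)$, $\bigcirc\mathbf s=s_0\circ\cdots\circ s_{k-1}$, $\mathrm{Seq}(\mathbf s)$ is the set of all rearrangements of $\mathbf s$, and $\mathrm{Prod}(\mathbf s)=\{\bigcirc\mathbf r:\mathbf r\in\mathrm{Seq}(\mathbf s)\}$. $\mathbf s$ is perm-complete iff $\mathrm{Prod}(\mathbf s)\in\{\mathrm{Alt}(n),\mathrm{Sym}(n)\setminus\mathrm{Alt}(n)\}$. *)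

(* Defs.v *)
From mathcomp Require Import all_boot all_fingroup all_solvable.

Set Implicit Arguments.
Unset Strict Implicit.
Unset Printing Implicit Defensive.

Local Open Scope group_scope.

Section PermComplete.

Variable n : nat.
Implicit Type s : seq 'S_n.

(* The group law of 'S_n composes left to right:
   permM : (p * q) x = q (p x). *)
Definition bigcirc s : 'S_n := \prod_(p <- s) p.

Definition Seqs s : seq (seq 'S_n) := permutations s.

Definition Prods s : {set 'S_n} := [set p in [seq bigcirc r | r <- Seqs s]].

Definition perm_complete s : Prop :=
  Prods s = 'Alt_('I_n) \/ Prods s = 'Sym_('I_n) :\: 'Alt_('I_n).

End PermComplete.

(* Main.v *)
Require Import Defs.
From mathcomp Require Import all_boot all_fingroup all_solvable.

(** All rearrangements of a sequence have products of the same parity, so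
    perm-completeness of [s] only asks that every permutation of the parity of
    [bigcirc s] be a rearranged product.  If [t] is a rearrangement of [s ++ u]
    and [p] has the parity of [bigcirc t], then [p * (bigcirc u)^-1] has the
    parity of [bigcirc s], hence is a product over a rearrangement of [s];
    multiplying by [bigcirc u] recovers [p]. *)

Local Open Scope group_scope.

Section PermComplete.

Variable n : nat.
Implicit Types (s t u r : seq 'S_n) (p : 'S_n).

Lemma ProdsP s p :
  reflect (exists2 r, perm_eq r s & p = bigcirc r) (p \in Prods s).
Proof.
rewrite inE; apply: (iffP mapP) => -[r rs ->]; exists r => //;
by rewrite mem_permutations in rs *.
Qed.

(** Moves the product into booleans under [addb], which commute, so the order of the terms no longer
    matters. *)
Lemma odd_perm_bigcirc s : bigcirc s = \big[addb/false]_(p <- s) odd_perm p :> bool.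
Proof. exact: (big_morph _ (@odd_permM _) (@odd_perm1 _)). Qed.

Lemma perm_odd_bigcirc r s : perm_eq r s -> bigcirc r = bigcirc s :> bool.
Proof. by move=> rs; rewrite !odd_perm_bigcirc (perm_big _ rs). Qed.

Lemma bigcirc_cat s u : bigcirc (s ++ u) = bigcirc s * bigcirc u.
Proof. exact: big_cat. Qed.

Lemma perm_completeP s :
  perm_complete s <-> (forall p, p = bigcirc s :> bool -> p \in Prods s).
Proof.
have sP : bigcirc s \in Prods s by apply/ProdsP; exists s.
split=> [[] Ps p ps | H].
(* [sP] tells which parity class [Prods s] is: the one containing [bigcirc s]. *)
- by move: sP; rewrite Ps !Alt_even ps.
- by move: sP; rewrite Ps !in_setD !Alt_even !in_setT ps.
have eP p : (p \in Prods s) = (odd_perm p == odd_perm (bigcirc s)).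
  apply/idP/eqP => [/ProdsP[r rs ->]|]; [exact: perm_odd_bigcirc | exact: H].
case sb: (odd_perm (bigcirc s)); [right | left]; apply/setP=> p;
by rewrite eP sb ?in_setD Alt_even ?in_setT ?negbK ?andbT ?eqb_id ?eqbF_neg.
Qed.

End PermComplete.

Theorem theorem2p1 (n : nat) (s t : seq 'S_n)
  (hs : perm_complete s) (hst : subseq s t) : perm_complete t.
Proof.
(* [u] lists the inserted terms; [Prods t] ignores their positions, so they may be gathered after
   [s]. *)
have [u tsu] := perm_to_subseq hst.
apply/perm_completeP => p pt.
have /ProdsP[r rs pr] : p * (bigcirc u)^-1 \in Prods s.
  move/perm_completeP: hs; apply.
  (* The parity of [u] occurs twice and cancels. *)
  rewrite odd_permM odd_permV pt (perm_odd_bigcirc _ _ _ tsu).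
  by rewrite bigcirc_cat odd_permM addbK.
apply/ProdsP; exists (r ++ u); last by rewrite bigcirc_cat -pr mulgKV.
by rewrite (permPr tsu) perm_cat2r.
Qed.
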